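(* Let $1\le p<\infty$, $m\ge1$ and let $X,Y$ be Banach spaces over $\mathbb{K}$. Every factorable strongly $p$-summing $m$-homogeneous polynomial $P:X\to Y$ is weakly compact.
   Context: $\mathbb{K}=\mathbb{R}$ or $\mathbb{C}$. A polynomial $P:X\to Y$ is weakly compact if it maps the closed unit ball of $X$ to a relatively weakly compact subset of $Y$. $\mathcal{P}(^mX;Y)$ is the space of continuous $m$-homogeneous polynomials from $X$ to $Y$, and $\mathcal{P}(^mX)=\mathcal{P}(^mX;\mathbb{K})$ with the sup norm on the unit ball of $X$. A polynomial $P\in\mathcal{P}(^mX;Y)$ is factorable strongly $p$-summing if there is $C\ge0$ such that for all positive integers $m_1,m_2$, all $x_j^i\in X$ and all scalars $\lambda_j^i$ ($1\le j\le m_1$, $1\le i\le m_2$), $$\left(\sum_{j=1}^{m_1}\Big\|\sum_{i=1}^{m_2}\lambda_j^iP(x_j^i)\Big\|^p\right)^{1/p}\le C\sup_{q\in\mathcal{P}(^mX),\,\|q\|\le1}\left(\sum_{j=1}^{m_1}\Big|\sum_{i=1}^{m_2}\lambda_j^iq(x_j^i)\Big|^p\right)^{1/p}.$$ *)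

(* Defs.v *)
(* Conventions: R is an arbitrary [realType]; the scalar field K is R or R[i],
   and a Banach space over K is a [completeNormedModType K].  The library norm
   of such a space takes values in K. *)
From HB Require Import structures.
From mathcomp Require Import all_boot all_order all_algebra.
From mathcomp Require Import complex.
From mathcomp Require Import all_classical all_reals ereal topology normedtype.
From mathcomp Require Import sequences exp.

Import Order.TTheory GRing.Theory Num.Theory.
Import numFieldTopology.Exports numFieldNormedType.Exports.

Local Open Scope classical_set_scope.
Local Open Scope ring_scope.

Variant scalar_kind := RealScalars | ComplexScalars.

Definition scalar_field (R : realType) (k : scalar_kind) : numFieldType :=
  match k with
  | RealScalars => R
  | ComplexScalars => R[i]
  end.

(* The norm as an element of R: over R[i] the library norm is a complex number
   with zero imaginary part, so taking the real part loses nothing. *)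
Definition rnorm {R : realType} {k : scalar_kind} :
    forall V : normedModType (scalar_field R k), V -> R :=
  match k with
  | RealScalars => fun (V : normedModType R) (v : V) => `|v|
  | ComplexScalars => fun (V : normedModType R[i]) (v : V) => complex.Re `|v|
  end.
Arguments rnorm {R k} [V] v.

Section Polynomials.
Context {K : numFieldType}.

(* [dfwith x u] is the tuple x with its i-th entry replaced by u. *)
Definition multilinear {m : nat} {X Y : normedModType K}
    (A : ('I_m -> X) -> Y) : Prop :=
  forall (i : 'I_m) (x : 'I_m -> X),
    linear (fun u : X => A (@dfwith 'I_m (fun=> X) x i u)).

Definition homogeneous_polynomial (m : nat) {X Y : normedModType K}
    (P : X -> Y) : Prop :=
  exists2 A : ('I_m -> X) -> Y,
    multilinear A & forall x : X, P x = A (fun=> x).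

Definition continuous_polynomials (m : nat) (X Y : normedModType K) :
    set (X -> Y) :=
  [set P | homogeneous_polynomial m P /\ continuous P].

Definition unit_ball (X : normedModType K) : set X := [set x | `|x| <= 1].

Definition topological_dual (Y : normedModType K) : Type :=
  {f : {linear Y -> K^o} | continuous f}.

Definition weak_topology (Y : normedModType K) : topologicalType :=
  sup_topology (fun f : topological_dual Y =>
    Topological.class (initial_topology (sval f : Y -> K^o))).

(* [precompact B] means that B lies in a closed compact set, i.e. that its
   closure is compact (lemma [precompactE]). *)
Definition relatively_weakly_compact {Y : normedModType K} (B : set Y) : Prop :=
  @precompact (weak_topology Y) B.

Definition weakly_compact {X Y : normedModType K} (P : X -> Y) : Prop :=
  relatively_weakly_compact (P @` unit_ball X).

End Polynomials.

Section Summing.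
Context {R : realType} {k : scalar_kind}.
Local Notation K := (scalar_field R k).

Definition polynomial_norm {X Y : normedModType K} (P : X -> Y) : \bar R :=
  ereal_sup [set (rnorm (P x))%:E | x in unit_ball X].

Definition lp_sum (p : R) {X Y : normedModType K} (P : X -> Y) {m1 m2 : nat}
    (lambda : 'I_m1 -> 'I_m2 -> K) (x : 'I_m1 -> 'I_m2 -> X) : R :=
  (\sum_(j < m1) rnorm (\sum_(i < m2) lambda j i *: P (x j i)) `^ p) `^ p^-1.

(* The supremum is taken in the extended reals, so that it needs no side
   condition of boundedness. *)
Definition factorable_strongly_summing (p : R) (m : nat)
    {X Y : normedModType K} (P : X -> Y) : Prop :=
  exists2 C : R, 0 <= C &
    forall (m1 m2 : nat), (0 < m1)%N -> (0 < m2)%N ->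
    forall (x : 'I_m1 -> 'I_m2 -> X) (lambda : 'I_m1 -> 'I_m2 -> K),
      ((lp_sum p P lambda x)%:E <=
       C%:E * ereal_sup [set (lp_sum p q lambda x)%:E
         | q in continuous_polynomials m X K^o
                `&` [set q | polynomial_norm q <= 1]])%E.

End Summing.

(* Main.v *)
Require Import Defs.
From mathcomp Require Import all_boot all_order all_algebra.
From mathcomp Require Import complex zify ring lra.
From mathcomp Require Import all_classical all_reals ereal topology normedtype.
From mathcomp Require Import sequences exp.
Import Order.TTheory GRing.Theory Num.Theory.
Import numFieldTopology.Exports numFieldNormedType.Exports.

(** Linearize: the formal sums z = sum_i lambda_i [x_i] with scalar coefficients
    and points of X are paired with scalar polynomials by
    q(z) = sum_i lambda_i q(x_i), and P extends to them in the same way.  In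
    these terms the hypothesis says that the extension of P is an absolutely
    p-summing linear map when the q in the unit ball of the scalar m-homogeneous
    polynomials play the role of the dual ball, and the image of the unit ball
    of X is contained in the image of the sums on which every such q is at most
    1 in modulus.  So it is enough that absolutely p-summing linear maps are
    weakly compact.

    This is obtained without Pietsch's domination theorem and without the
    reflexivity of L_p, from a finite martingale estimate ([dyadic_tree]).
    Take a filter base of sets of formal sums, closed under midpoints and
    contained in the unit ball.  Suppose that every y in Y has distance at least
    delta from the image of some member of the base.  Then, going along the
    leaves of a dyadic tree of depth n, one finds 2^n formal sums such that at
    every inner node the averages over the left and the right half have images
    at distance at least delta.  List the difference of these two averages once
    for each leaf below the node: there are n 2^n differences w with
    |P(w)| >= delta, while the parallelogram law gives
    sum_w |q(w)|^2 <= 4 2^n for every q of norm at most 1.  As |q(w)| <= 2 and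
    a^p <= eps + c a^2 on [0, 2] ([powR_le_eps_sqr]), the summing inequality
    with constant C yields n delta^p <= C^p (n eps + 4 c) for all n, which is
    absurd when eps is small and n large.  Hence some y is within delta of the image of every member
    ([approximate_limit]).  Restricting the base to the sums whose images are
    close to y and repeating with delta = 2^-1, 2^-2, ... produces a Cauchy
    sequence; its limit is adherent to the image of every member
    ([limit_point]).

    Finally let F be an ultrafilter, for the weak topology, on the weak closure
    of the image of the unit ball.  Apply this to the midpoint hulls of the
    sets of points x of the ball with P(x) in U, where U ranges over the weakly
    open members of F.  The point y found is the weak limit of F
    ([hulls_cvg]): otherwise a closed half-space missing y belongs to F, and a
    slightly larger open half-space contains the image of a midpoint hull to
    which y is adherent. *)

Local Open Scope classical_set_scope.
Local Open Scope ring_scope.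

(** * Real-valued norms and real coordinates of scalars *)

Lemma expr_half_lt (R : realType) (e : R) : 0 < e -> exists n, 2^-1 ^+ n < e.
Proof.
move=> e0; have /cvgrPdist_lt/(_ e e0) : 2^-1 ^+ n @[n --> \oo] --> (0 : R).
  apply: cvg_expr; rewrite ger0_norm ?invr_ge0 ?ler0n//.
  by rewrite invf_lt1 ?ltr1n ?ltr0n.
move=> [n _ /(_ n)]/= /(_ (leqnn _)) ne; exists n; move: ne.
by rewrite sub0r normrN ger0_norm// exprn_ge0// invr_ge0.
Qed.

Section RealNorm.
Context {R : realType} {k : scalar_kind}.
Local Notation K := (scalar_field R k).

(** The embedding of the reals into the scalar field. *)
Definition of_real : R -> K :=
  match k return R -> scalar_field R k with
  | RealScalars => fun r => r
  | ComplexScalars => fun r => Complex r 0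
  end.

Lemma of_real_rnorm (V : normedModType K) (v : V) : of_real (rnorm v) = `|v|.
Proof.
rewrite /of_real /rnorm; case: k V v => //= V v.
by rewrite -[LHS]/((complex.Re `|v|)%:C)%C RRe_real// normr_real.
Qed.

Lemma ler_of_real a b : (of_real a <= of_real b) = (a <= b).
Proof. by rewrite /of_real; case: k => //=; exact: lecR. Qed.

Lemma of_realD a b : of_real (a + b) = of_real a + of_real b.
Proof.
by rewrite /of_real; case: k => //=; exact: (rmorphD (real_complex R)).
Qed.

Lemma of_realM a b : of_real (a * b) = of_real a * of_real b.
Proof.
by rewrite /of_real; case: k => //=; exact: (rmorphM (real_complex R)).
Qed.

Lemma of_real1 : of_real 1 = 1.
Proof.
by rewrite /of_real; case: k => //=; exact: (rmorph1 (real_complex R)).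
Qed.

Lemma of_real_inj : injective of_real.
Proof. by move=> a b ab; apply/eqP; rewrite eq_le -!ler_of_real ab lexx. Qed.

Lemma of_real0 : of_real 0 = 0.
Proof. by apply: (addrI (of_real 0)); rewrite -of_realD !addr0. Qed.

Lemma of_real_half : of_real 2^-1 = 2^-1.
Proof.
apply: (@mulIf _ 2); first by rewrite pnatr_eq0.
have e2 : of_real 2 = 2 by rewrite -[2 in LHS]/(1 + 1) of_realD of_real1.
by rewrite mulVf ?pnatr_eq0// -e2 -of_realM mulVf ?pnatr_eq0// of_real1.
Qed.

Lemma of_real_ex (e : K) : 0 < e -> exists2 r : R, 0 < r & of_real r = e.
Proof.
rewrite /of_real; case: k e => /= e e0; first by exists e.
exists (complex.Re e); first by move: e0; rewrite ltcE => /andP[].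
by rewrite -[LHS]/((complex.Re e)%:C)%C RRe_real// gtr0_real.
Qed.

Lemma ltr_of_real a b : (of_real a < of_real b) = (a < b).
Proof. by rewrite !lt_neqAle ler_of_real (inj_eq of_real_inj). Qed.

Section Normed.
Context {V : normedModType K}.
Implicit Types u v w : V.

Lemma rnorm_ge0 v : 0 <= rnorm v.
Proof. by rewrite -ler_of_real of_real_rnorm of_real0. Qed.

Lemma rnorm0 : rnorm (0 : V) = 0.
Proof. by apply: of_real_inj; rewrite of_real_rnorm normr0 of_real0. Qed.

Lemma rnormN v : rnorm (- v) = rnorm v.
Proof. by apply: of_real_inj; rewrite !of_real_rnorm normrN. Qed.

Lemma ler_rnormD u v : rnorm (u + v) <= rnorm u + rnorm v.
Proof. by rewrite -ler_of_real of_realD !of_real_rnorm ler_normD. Qed.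

Lemma ler_rnormB u v w : rnorm (u - w) <= rnorm (u - v) + rnorm (v - w).
Proof. by apply: le_trans (ler_rnormD _ _); rewrite addrA subrK. Qed.

Lemma rnormB u v : rnorm (u - v) = rnorm (v - u).
Proof. by rewrite -rnormN opprB. Qed.

Lemma rnorm_half v : rnorm (2^-1 *: v) = 2^-1 * rnorm v.
Proof.
apply: of_real_inj; rewrite of_realM !of_real_rnorm normrZ of_real_half.
by rewrite ger0_norm// invr_ge0 ler0n.
Qed.

Lemma rnorm_mid u v w r : rnorm (u - w) < r -> rnorm (v - w) < r ->
  rnorm (2^-1 *: (u + v) - w) < r.
Proof.
move=> ur vr.
have -> : 2^-1 *: (u + v) - w = 2^-1 *: ((u - w) + (v - w)).
  rewrite addrACA -opprD scalerBr -[w + w]/(w *+ 2) -(scaler_nat 2 w) scalerA.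
  by rewrite mulVf ?pnatr_eq0// scale1r.
by rewrite rnorm_half; have := ler_rnormD (u - w) (v - w); lra.
Qed.

Lemma nbhs_rnorm v (r : R) : 0 < r -> nbhs v [set w | rnorm (w - v) < r].
Proof.
move=> r0; apply/nbhs_normP; exists (of_real r).
  by rewrite /= -of_real0 ltr_of_real.
by move=> w /=; rewrite -of_real_rnorm ltr_of_real rnormB.
Qed.

Lemma nbhs_rnormP v (A : set V) :
  nbhs v A -> exists2 r : R, 0 < r & [set w | rnorm (w - v) < r] `<=` A.
Proof.
move=> /nbhs_normP[e /= e0 eA]; have [r r0 re] := of_real_ex _ e0.
exists r => // w wr; apply: eA => /=.
by rewrite -of_real_rnorm -re ltr_of_real rnormB.
Qed.

End Normed.

(** Completeness, with a speed of convergence. *)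
Lemma rnorm_complete (V : completeNormedModType K) (u : nat -> V) :
  (forall n, rnorm (u n.+1 - u n) <= 2^-1 ^+ n) ->
  exists v, forall n, rnorm (u n - v) <= 3 * 2^-1 ^+ n.
Proof.
move=> uh.
have ub n j : rnorm (u (n + j)%N - u n) <= 2 * 2^-1 ^+ n.
  have e0 i : 0 <= 2^-1 ^+ i :> R by rewrite exprn_ge0// invr_ge0 ler0n.
  suff : rnorm (u (n + j)%N - u n) <= 2 * 2^-1 ^+ n - 2 * 2^-1 ^+ (n + j)%N.
    by have := e0 (n + j)%N; lra.
  elim: j => [|j IH]; first by rewrite addn0 !subrr rnorm0.
  rewrite addnS; have := ler_rnormB (u (n + j).+1) (u (n + j)%N) (u n).
  by have := uh (n + j)%N; rewrite exprS; lra.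
have /cvg_ex[v uv] : cvg (u @ \oo).
  apply/cauchy_cvgP/cauchyP => e e0.
  have [r r0 re] := of_real_ex _ e0.
  have r2 : 0 < r / 2 by rewrite divr_gt0.
  have [n nr] := expr_half_lt _ _ r2.
  exists (u n), n => // j /= nj.
  rewrite -ball_normE /ball_/= -of_real_rnorm -re ltr_of_real rnormB.
  rewrite -(subnKC nj).
  by apply: le_lt_trans (ub _ _) _; move: nr; lra.
exists v => n.
have e0 : 0 < 2^-1 ^+ n :> R by rewrite exprn_gt0// invr_gt0.
have [N _ /(_ (N + n)%N (leq_addr _ _))/= Nv] := uv _ (nbhs_rnorm v _ e0).
have := ler_rnormB (u n) (u (n + N)%N) v; have := ub n N.
by rewrite [rnorm (u n - u _)]rnormB; move: Nv; rewrite addnC; lra.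
Qed.

Lemma parallelogram (a b : K^o) :
  rnorm (2^-1 *: (a + b)) ^+ 2 + 4^-1 * rnorm (a - b) ^+ 2 =
  2^-1 * (rnorm a ^+ 2 + rnorm b ^+ 2).
Proof.
rewrite rnorm_half.
suff : rnorm (a + b) ^+ 2 + rnorm (a - b) ^+ 2 =
  2 * (rnorm a ^+ 2 + rnorm b ^+ 2) by lra.
move: a b; rewrite /rnorm; case: k => /= a b.
  rewrite -!normrX !ger0_norm ?sqr_ge0//; ring.
pose N (z : R[i]) := complex.Re z ^+ 2 + complex.Im z ^+ 2.
have nE (z : R[i]) : complex.Re `|z : R[i]^o| ^+ 2 = N z.
  rewrite [X in X ^+ 2](congr1 (@complex.Re R) (normc_def z)) sqr_sqrtr//.
  by rewrite addr_ge0 ?sqr_ge0.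
rewrite (nE a) (nE b) (nE (a + b)) (nE (a - b)) /N.
by case: a b => [a1 a2] [b1 b2] /=; ring.
Qed.

(** What is used of the real and imaginary parts of a scalar; of real-linearity,
    only additivity and compatibility with halving matter for midpoints. *)
Definition real_coordinate (g : K -> R) :=
  [/\ forall a b, g (a + b) = g a + g b,
      forall a, g (2^-1 * a) = 2^-1 * g a &
      forall a : K^o, `|g a| <= rnorm a].

Lemma real_coordinates : exists g1 g2 : K -> R,
  [/\ real_coordinate g1, real_coordinate g2 &
      forall a : K^o, rnorm a <= `|g1 a| + `|g2 a|].
Proof.
rewrite /real_coordinate /rnorm; case: k => /=.
  exists id, (fun=> 0); split; first by split.
  - by split => *; rewrite ?addr0 ?mulr0 ?normr0.
  - by move=> a; rewrite normr0 addr0.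
pose N (z : R[i]) := Num.sqrt (complex.Re z ^+ 2 + complex.Im z ^+ 2).
have nE (z : R[i]) : complex.Re `|z : R[i]^o| = N z.
  exact: (congr1 (@complex.Re R) (normc_def z)).
exists (@complex.Re R), (@complex.Im R).
have halfE : (2^-1 : R[i]) = ((2^-1 : R)%:C)%C by rewrite fmorphV/= rmorph_nat.
split; first split.
- by move=> [a1 a2] [b1 b2].
- by move=> [a1 a2]; rewrite halfE /= mul0r subr0.
- by move=> a; rewrite [leRHS](nE a) -sqrtr_sqr ler_wsqrtr// lerDl sqr_ge0.
- split.
  + by move=> [a1 a2] [b1 b2].
  + by move=> [a1 a2]; rewrite halfE /= mul0r addr0.
  + by move=> a; rewrite [leRHS](nE a) -sqrtr_sqr ler_wsqrtr// lerDr sqr_ge0.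
- move=> a; rewrite [leLHS](nE a) -ler_sqr ?nnegrE ?sqrtr_ge0 ?addr_ge0//.
  rewrite sqr_sqrtr ?addr_ge0 ?sqr_ge0// sqrrD !real_normK ?num_real//.
  by rewrite lerD2r lerDl mulrn_wge0// mulr_ge0.
Qed.
End RealNorm.

(** * Formal sums and midpoint hulls *)

Section FormalSums.
Context {K : numFieldType} {X : normedModType K}.

(** A finite formal sum of points of X with scalar coefficients, as the list of
    its terms; sums equal as vectors need not be identified, since they are only
    used through [ev]. *)
Definition formal_sum : Type := seq (K * X).

(** The value at a formal sum of the linear extension of g. *)
Definition ev {V : lmodType K} (g : X -> V) (z : formal_sum) : V :=
  \sum_(t <- z) t.1 *: g t.2.

(** Half the sum of two formal sums. *)
Definition mid (z1 z2 : formal_sum) : formal_sum :=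
  [seq (2^-1 * t.1, t.2) | t <- z1 ++ z2].

Definition diff (z1 z2 : formal_sum) : formal_sum :=
  z1 ++ [seq (- t.1, t.2) | t <- z2].

Lemma ev_mid (V : lmodType K) (g : X -> V) z1 z2 :
  ev g (mid z1 z2) = 2^-1 *: (ev g z1 + ev g z2).
Proof.
rewrite /ev /mid big_map -big_cat scaler_sumr.
by apply: eq_bigr => t _; rewrite scalerA.
Qed.

Lemma ev_diff (V : lmodType K) (g : X -> V) z1 z2 :
  ev g (diff z1 z2) = ev g z1 - ev g z2.
Proof.
rewrite /ev /diff big_cat big_map -sumrN; congr (_ + _).
by apply: eq_bigr => t _; rewrite scaleNr.
Qed.

Lemma ev_seq1 (V : lmodType K) (g : X -> V) x : ev g [:: (1, x)] = g x.
Proof. by rewrite /ev big_seq1 scale1r. Qed.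

(** Padding with terms of coefficient 0, as needed to bring several formal sums
    to a common length. *)
Lemma ev_nth (V : lmodType K) (g : X -> V) z n : (size z <= n)%N ->
  \sum_(i < n) (nth (0, 0) z i).1 *: g (nth (0, 0) z i).2 = ev g z.
Proof.
move=> zn; rewrite /ev (big_nth (0, 0)).
pose F i := (nth (0, 0) z i).1 *: g (nth (0, 0) z i).2.
rewrite -(big_mkord xpredT F) (big_cat_nat (leq0n (size z)) zn)//= /F.
rewrite [X in _ + X]big_nat [X in _ + X]big1 ?addr0// => i /andP[zi _].
by rewrite nth_default// scale0r.
Qed.

(** The least set of formal sums that contains the points of A and is closed
    under midpoints: the convex combinations with dyadic coefficients. *)
Inductive midpoint_hull (A : set X) : formal_sum -> Prop :=
| midpoint_hull_point x : A x -> midpoint_hull A [:: (1, x)]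
| midpoint_hull_mid z1 z2 : midpoint_hull A z1 -> midpoint_hull A z2 ->
    midpoint_hull A (mid z1 z2).

Lemma midpoint_hull_sub A B : A `<=` B -> midpoint_hull A `<=` midpoint_hull B.
Proof.
move=> AB z; elim=> [x /AB|z1 z2 _ h1 _ h2]; first exact: midpoint_hull_point.
exact: midpoint_hull_mid.
Qed.

End FormalSums.
Arguments formal_sum {K} X.

(** * The summing inequality for lists of formal sums *)

Lemma powR_le_eps_sqr (R : realType) (p e : R) : 0 < p -> 0 < e ->
  exists2 c, 0 <= c & forall a, 0 <= a <= 2 -> a `^ p <= e + c * a ^+ 2.
Proof.
move=> p0 e0; have r0 : 0 < e `^ p^-1 by rewrite powR_gt0.
exists (2 `^ p / (e `^ p^-1) ^+ 2).
  by rewrite divr_ge0 ?powR_ge0// sqr_ge0.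
move=> a /andP[a0 a2]; have [ar|ra] := leP a (e `^ p^-1).
  have re : (e `^ p^-1) `^ p = e.
    by rewrite -powRrM mulVf ?lt0r_neq0// powRr1// ltW.
  apply: (@le_trans _ _ ((e `^ p^-1) `^ p)).
    by apply: ge0_ler_powR; rewrite ?nnegrE ?powR_ge0// ltW.
  by rewrite re lerDl mulr_ge0 ?divr_ge0 ?powR_ge0 ?sqr_ge0.
apply: (@le_trans _ _ (2 `^ p)).
  by apply: ge0_ler_powR; rewrite ?nnegrE// ltW.
rewrite -[leLHS]add0r; apply: lerD; first exact: ltW.
rewrite mulrAC -mulrA ler_peMr ?powR_ge0//.
by rewrite ler_pdivlMr ?exprn_gt0// mul1r ler_sqr ?nnegrE// ltW.
Qed.

Section Summing.
Context {R : realType} {k : scalar_kind}.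
Local Notation K := (scalar_field R k).
Context {X : normedModType K}.

Lemma lp_sum_ev (p : R) (V : normedModType K) (g : X -> V)
    (W : seq (formal_sum X)) n : (forall w, w \in W -> (size w <= n)%N) ->
  lp_sum p g
    (fun (j : 'I_(size W)) (i : 'I_n) => (nth (0, 0) (nth [::] W j) i).1)
    (fun j i => (nth (0, 0) (nth [::] W j) i).2) =
  (\sum_(w <- W) rnorm (ev g w) `^ p) `^ p^-1.
Proof.
move=> Wn; rewrite /lp_sum; congr (_ `^ _); rewrite (big_nth [::]) big_mkord.
by apply: eq_bigr => j _; rewrite ev_nth// Wn// mem_nth.
Qed.

(** The p-th power of the summing inequality, for a list of formal sums of any
    lengths. *)
Lemma summing_seq (p C : R) (Q : set (X -> K^o)) (Y : normedModType K)
    (P : X -> Y) : 0 < p -> 0 <= C ->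
  (forall (m1 m2 : nat), (0 < m1)%N -> (0 < m2)%N ->
    forall (x : 'I_m1 -> 'I_m2 -> X) (lambda : 'I_m1 -> 'I_m2 -> K),
      ((lp_sum p P lambda x)%:E <=
       C%:E * ereal_sup [set (lp_sum p q lambda x)%:E | q in Q])%E) ->
  forall (W : seq (formal_sum X)) (M : R), 0 <= M ->
    (forall q, Q q -> \sum_(w <- W) rnorm (ev q w) `^ p <= M) ->
  \sum_(w <- W) rnorm (ev P w) `^ p <= C `^ p * M.
Proof.
move=> p0 C0 hsum W M M0 WM; have p1 : 0 <= p^-1 by rewrite invr_ge0 ltW.
have [->|W0] := eqVneq W [::]; first by rewrite big_nil mulr_ge0 ?powR_ge0.
have S0 (V : normedModType K) (g : X -> V) :
    0 <= \sum_(w <- W) rnorm (ev g w) `^ p.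
  by apply: sumr_ge0 => w _; exact: powR_ge0.
have W1 : (0 < size W)%N by rewrite lt0n size_eq0.
have Wn w : w \in W -> (size w <= (\max_(w <- W) size w).+1)%N.
  by move=> wW; apply: leqW; exact: leq_bigmax_seq.
have := hsum _ _ W1 (ltn0Sn (\max_(w <- W) size w))
  (fun j i => (nth (0, 0) (nth [::] W j) i).2)
  (fun j i => (nth (0, 0) (nth [::] W j) i).1).
rewrite lp_sum_ev// => hP.
have : (\sum_(w <- W) rnorm (ev P w) `^ p) `^ p^-1 <= C * M `^ p^-1.
  rewrite -lee_fin EFinM; apply: le_trans hP _.
  apply: lee_wpmul2l; first by rewrite lee_fin.
  apply: ge_ereal_sup => _ [q Qq <-]; rewrite lp_sum_ev// lee_fin.
  by apply: ge0_ler_powR; rewrite ?nnegrE//; exact: WM.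
move=> /(ge0_ler_powR (ltW p0)); rewrite !nnegrE.
rewrite powR_ge0 mulr_ge0 ?powR_ge0// powRM ?powR_ge0// -!powRrM.
by rewrite mulVf ?lt0r_neq0// !powRr1//; apply.
Qed.

End Summing.

(** * The dyadic tree argument *)

Section Approximation.
Context {R : realType} {k : scalar_kind}.
Local Notation K := (scalar_field R k).
Context {X : normedModType K} (Q : set (X -> K^o)).
Implicit Type CC : set (set (formal_sum X)).

(** A filter base of midpoint-closed sets of formal sums that lie in the polar
    of Q. *)
Record convex_filter_base CC : Prop := ConvexFilterBase {
  cfb_ex : CC !=set0;
  cfb_nonempty : forall C, CC C -> C !=set0;
  cfb_mid : forall C z1 z2, CC C -> C z1 -> C z2 -> C (mid z1 z2);
  cfb_bounded : forall C z q, CC C -> C z -> Q q -> rnorm (ev q z) <= 1;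
  cfb_meet : forall C1 C2, CC C1 -> CC C2 ->
    exists2 C, CC C & C `<=` C1 `&` C2 }.

Context {Y : normedModType K} (P : X -> Y).

(** A tree of depth n with root average z and list W of differences.  The
    energy inequality comes from the parallelogram law, by induction on n. *)
Lemma dyadic_tree CC (delta : R) : convex_filter_base CC ->
  (forall y, exists2 C, CC C & forall z, C z -> delta <= rnorm (ev P z - y)) ->
  forall n C, CC C -> exists z W,
    [/\ C z, size W = (n * 2 ^ n)%N,
        forall w, w \in W -> delta <= rnorm (ev P w),
        forall w q, w \in W -> Q q -> rnorm (ev q w) <= 2 &
        forall q, Q q ->
          4^-1 * (\sum_(w <- W) rnorm (ev q w) ^+ 2)
            + 2 ^+ n * rnorm (ev q z) ^+ 2 <= 2 ^+ n].
Proof.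
move=> CCb far; elim=> [|n IH] C CCC.
  have [z Cz] := cfb_nonempty _ CCb _ CCC; exists z, [::]; split => // q Qq.
  rewrite big_nil mulr0 add0r expr0 mul1r -[leRHS](expr1n _ 2).
  by rewrite ler_sqr ?nnegrE ?rnorm_ge0// (cfb_bounded _ CCb _ _ _ CCC).
have [z1 [W1 [Cz1 sW1 dW1 bW1 eW1]]] := IH _ CCC.
have [C1 CC1 far1] := far (ev P z1).
have [C2 CC2 C2sub] := cfb_meet _ CCb _ _ CCC CC1.
have [z2 [W2 [Cz2 sW2 dW2 bW2 eW2]]] := IH _ CC2.
have [{}Cz2 C1z2] := C2sub _ Cz2.
(* The difference at the root has weight 2^(n+1), the number of its leaves. *)
exists (mid z1 z2), (nseq (2 ^ n.+1) (diff z1 z2) ++ W1 ++ W2); split.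
- exact: (cfb_mid _ CCb).
- by rewrite !size_cat sW1 sW2 size_nseq expnS; lia.
- move=> w; rewrite !mem_cat mem_nseq => /orP[/andP[_ /eqP->]|].
    by rewrite ev_diff rnormB far1.
  by move=> /orP[/dW1|/dW2].
- move=> w q; rewrite !mem_cat mem_nseq => /orP[/andP[_ /eqP->] Qq|].
    have := ler_rnormD (ev q z1) (- ev q z2); rewrite ev_diff rnormN.
    have := cfb_bounded _ CCb _ _ _ CCC Cz1 Qq.
    by have := cfb_bounded _ CCb _ _ _ CCC Cz2 Qq; lra.
  by move=> /orP[/bW1|/bW2]; exact.
- move=> q Qq; rewrite !big_cat/= big_nseq iter_addr_0 ev_diff ev_mid.
  rewrite -[X in _ * (X + _)]mulr_natl natrX exprS.
  have := parallelogram (ev q z1) (ev q z2).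
  have := eW1 _ Qq; have := eW2 _ Qq.
  set s1 := \sum_(w <- W1) _; set s2 := \sum_(w <- W2) _.
  set a := rnorm _ ^+ 2; set b := rnorm (ev q z1) ^+ 2.
  set c := rnorm (_ *: _) ^+ 2.
  set d := rnorm (_ - _) ^+ 2; set N := 2 ^+ n => h1 h2 h3.
  have -> : c = 2^-1 * (b + a) - 4^-1 * d by rewrite -h3; lra.
  lra.
Qed.

Context (p D : R) (p0 : 0 < p) (D0 : 0 <= D).
Context (summing : forall (W : seq (formal_sum X)) (M : R), 0 <= M ->
  (forall q, Q q -> \sum_(w <- W) rnorm (ev q w) `^ p <= M) ->
  \sum_(w <- W) rnorm (ev P w) `^ p <= D * M).

Lemma approximate_limit CC (delta : R) : convex_filter_base CC -> 0 < delta ->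
  exists y, forall C, CC C -> exists2 z, C z & rnorm (ev P z - y) < delta.
Proof.
move=> CCb d0; apply: contrapT => /forallNP noy.
have far y : exists2 C, CC C & forall z, C z -> delta <= rnorm (ev P z - y).
  have /existsNP[C /not_implyP[CCC noz]] := noy y; exists C => // z Cz.
  by rewrite leNgt; apply/negP => zy; apply: noz; exists z.
have [C0 CC0] := cfb_ex _ CCb.
have dp0 : 0 < delta `^ p by rewrite powR_gt0.
set dp := delta `^ p in dp0.
(* eps = delta^p / (2 (D + 1)) makes D eps at most delta^p / 2. *)
have e0 : 0 < dp / (2 * (D + 1)) by rewrite divr_gt0// mulr_gt0// ltr_wpDl.
have De : D * (dp / (2 * (D + 1))) <= dp / 2.
  rewrite mulrA ler_pdivrMr ?mulr_gt0 ?ltr_wpDl//.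
  by rewrite [leRHS](_ : _ = dp * D + dp) ?[D * dp]mulrC ?lerDl ?ltW//; field.
have [c c0 hc] := powR_le_eps_sqr _ _ _ p0 e0.
move: (dp / (2 * (D + 1))) e0 De hc => e e0 De hc.
have bound n : n%:R * dp <= 8 * (D * c).
  have [z [W [_ sW dW bW eW]]] := dyadic_tree _ _ CCb far n _ CC0.
  have N0 : 0 < 2 ^+ n :> R by rewrite exprn_gt0.
  have sE (r : R) : \sum_(w <- W) r = n%:R * 2 ^+ n * r.
    rewrite big_const_seq count_predT iter_addr_0 sW.
    by rewrite -[LHS]mulr_natl natrM natrX.
  have lo : n%:R * 2 ^+ n * dp <= \sum_(w <- W) rnorm (ev P w) `^ p.
    rewrite -sE !big_seq; apply: ler_sum => w wW.
    by apply: ge0_ler_powR; rewrite ?nnegrE ?rnorm_ge0 ?dW// ltW.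
  have M0 : 0 <= n%:R * 2 ^+ n * e + c * (4 * 2 ^+ n).
    by rewrite addr_ge0 ?mulr_ge0// ltW.
  have hi q : Q q -> \sum_(w <- W) rnorm (ev q w) `^ p <=
      n%:R * 2 ^+ n * e + c * (4 * 2 ^+ n).
    move=> Qq.
    apply: (@le_trans _ _ (\sum_(w <- W) (e + c * rnorm (ev q w) ^+ 2))).
      rewrite !big_seq; apply: ler_sum => w wW.
      by apply: hc; rewrite rnorm_ge0 bW.
    rewrite big_split/= sE lerD2l -mulr_sumr ler_wpM2l//.
    have := eW _ Qq; have : 0 <= 2 ^+ n * rnorm (ev q z) ^+ 2.
      by rewrite mulr_ge0 ?sqr_ge0// ltW.
    lra.
  have := le_trans lo (summing _ _ M0 hi).
  have -> : n%:R * 2 ^+ n * dp = 2 ^+ n * (n%:R * dp) by ring.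
  have -> : D * (n%:R * 2 ^+ n * e + c * (4 * 2 ^+ n)) =
    2 ^+ n * (n%:R * (D * e) + 4 * (D * c)) by ring.
  rewrite ler_pM2l//; have := ler_wpM2l (ler0n R n) De; lra.
have := archi_boundP
  (divr_ge0 (mulr_ge0 (ler0n R 8) (mulr_ge0 D0 c0)) (ltW dp0)).
by rewrite ltr_pdivrMr// ltNge bound.
Qed.

End Approximation.

(** * A point adherent to all images *)

Section Limit.
Context {R : realType} {k : scalar_kind}.
Local Notation K := (scalar_field R k).
Context {X : normedModType K} (Q : set (X -> K^o)).
Context {Y : completeNormedModType K} (P : X -> Y).
Implicit Type CC : set (set (formal_sum X)).
Context (approx : forall CC (delta : R), convex_filter_base Q CC -> 0 < delta ->
  exists y, forall C, CC C -> exists2 z, C z & rnorm (ev P z - y) < delta).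

(** A point of Y within delta of the image of every member of CC, or 0 if there
    is none. *)
Definition approx_point CC (delta : R) : Y :=
  xget 0 [set y | forall C, CC C ->
    exists2 z, C z & rnorm (ev P z - y) < delta].

(** The members of CC cut down to the formal sums with image within delta of
    [approx_point CC delta]. *)
Definition near_point CC (delta : R) : set (set (formal_sum X)) :=
  [set C `&` [set z | rnorm (ev P z - approx_point CC delta) < delta] |
    C in CC].

Lemma approx_pointP CC (delta : R) : convex_filter_base Q CC -> 0 < delta ->
  forall C, CC C ->
    exists2 z, C z & rnorm (ev P z - approx_point CC delta) < delta.
Proof. by move=> CCb d0; apply: (xgetPex 0 (approx _ _ CCb d0)). Qed.

Lemma near_point_base CC (delta : R) : convex_filter_base Q CC -> 0 < delta ->
  convex_filter_base Q (near_point CC delta).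
Proof.
move=> CCb d0; split.
- by have [C CCC] := cfb_ex _ _ CCb; eexists; exists C.
- move=> _ [C CCC <-]; have [z Cz zy] := approx_pointP _ _ CCb d0 _ CCC.
  by exists z.
- move=> _ z1 z2 [C CCC <-] [Cz1 y1] [Cz2 y2]; split.
    exact: (cfb_mid _ _ CCb _ _ _ CCC).
  by rewrite /= ev_mid rnorm_mid.
- by move=> _ z q [C CCC <-] [Cz _]; exact: (cfb_bounded _ _ CCb _ _ _ CCC).
- move=> _ _ [C1 CC1 <-] [C2 CC2 <-].
  have [C CCC CC12] := cfb_meet _ _ CCb _ _ CC1 CC2.
  eexists; first by exists C.
  by move=> z [/CC12[]].
Qed.

Let radius n : R := 2^-1 ^+ n.+1.

Let radius_gt0 n : 0 < radius n.
Proof. by rewrite exprn_gt0// invr_gt0. Qed.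

Lemma limit_point CC : convex_filter_base Q CC ->
  exists y, forall C (e : R), CC C -> 0 < e ->
    exists2 z, C z & rnorm (ev P z - y) < e.
Proof.
move=> CCb.
pose fam := fix fam n :=
  if n is n'.+1 then near_point (fam n') (radius n') else CC.
have famb n : convex_filter_base Q (fam n).
  by elim: n => //= n IH; exact: near_point_base.
pose u n := approx_point (fam n) (radius n).
have famS n z C : fam n.+1 C -> C z -> rnorm (ev P z - u n) < radius n.
  by move=> [C' _ <-] [].
have [|y uy] := rnorm_complete Y u.
  (* A member of the next family has images near both u n and u (n + 1). *)
  move=> n; have [C fC] := cfb_ex _ _ (famb n.+1).
  have [z Cz zu] := approx_pointP _ _ (famb n.+1) (radius_gt0 n.+1) _ fC.
  have := famS _ _ _ fC Cz; have := ler_rnormB (u n.+1) (ev P z) (u n).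
  move: zu; rewrite -/(u n.+1) [rnorm (ev P z - u n.+1)]rnormB /radius !exprS.
  have : 0 < 2^-1 ^+ n :> R by rewrite exprn_gt0// invr_gt0.
  lra.
have fam_sub n C : CC C -> exists2 C', fam n C' & C' `<=` C.
  move=> CCC; elim: n => [|n [C' fC' C'C]]; first by exists C.
  exists (C' `&` [set z | rnorm (ev P z - u n) < radius n]); first by exists C'.
  by move=> z [/C'C].
exists y => C e CCC e0.
have e4 : 0 < e / 4 by rewrite divr_gt0.
have [n ne] := expr_half_lt _ _ e4.
have [C' fC' C'C] := fam_sub n _ CCC.
have [z C'z zu] := approx_pointP _ _ (famb n) (radius_gt0 n) _ fC'.
exists z; first exact: C'C.
have := ler_rnormB (ev P z) (u n) y; have := uy n; move: zu.
rewrite -/(u n) /radius exprS.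
have : 0 < 2^-1 ^+ n :> R by rewrite exprn_gt0// invr_gt0.
lra.
Qed.

End Limit.

(** * Weak limits of ultrafilters *)

Section WeakTopology.
Context {R : realType} {k : scalar_kind}.
Local Notation K := (scalar_field R k).
Context {X Y : normedModType K}.

Lemma real_coordinateN (g : K -> R) :
  real_coordinate g -> real_coordinate (fun a => - g a).
Proof.
move=> [gD gM gn]; split => a; [move=> b| |].
- by rewrite gD opprD.
- by rewrite gM mulrN.
- by rewrite normrN gn.
Qed.

Lemma real_coordinateB (g : K -> R) : real_coordinate g ->
  forall a b, g (a - b) = g a - g b.
Proof. by move=> [gD _ _] a b; apply/eqP; rewrite eq_sym subr_eq -gD subrK. Qed.

Lemma open_half_space (g : K -> R) (f : topological_dual Y) (c : R) :
  real_coordinate g -> @open (weak_topology Y) [set y | c < g (sval f y)].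
Proof.
move=> gc; have [gD gM gn] := gc.
have oc : @open (K^o) [set a | c < g a].
  rewrite openE => a /= ca.
  have : 0 < g a - c by rewrite subr_gt0.
  move=> /(nbhs_rnorm (a : K^o)); apply: filterS => b /=.
  have := gn (b - a); rewrite real_coordinateB// ler_norml => /andP[].
  lra.
have of' : @open (initial_topology (sval f : Y -> K^o))
    [set y | c < g (sval f y)].
  by exists [set a | c < g a].
rewrite openE => y /= cy.
have FF := @nbhs_filter (weak_topology Y) y.
(* The weak topology is finer than the initial topology of f. *)
apply: ((@cvg_sup _ _ _ _ _ FF).1 (@cvg_id (weak_topology Y) (nbhs y)) f).
exact: (@open_nbhs_nbhs (initial_topology (sval f : Y -> K^o))).
Qed.

End WeakTopology.

Section WeakLimit.
Context {R : realType} {k : scalar_kind}.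
Local Notation K := (scalar_field R k).
Context {X Y : normedModType K} (Q : set (X -> K^o)) (P : X -> Y).
Context (Q_ball : forall q x, Q q -> unit_ball X x -> rnorm (q x) <= 1).

Definition ball_preimage (U : set Y) : set X :=
  [set x | unit_ball X x /\ U (P x)].

(** The midpoint hulls of the preimages in the unit ball of the weakly open
    members of F.  Open members still meet the image of the ball when F lives on
    the weak closure of that image only. *)
Definition hulls (F : set_system (weak_topology Y)) :
    set (set (formal_sum X)) :=
  [set midpoint_hull (ball_preimage U) |
    U in [set U | @open (weak_topology Y) U /\ F U]].

Lemma hulls_base (F : set_system (weak_topology Y)) : ProperFilter F ->
  F (@closure (weak_topology Y) (P @` unit_ball X)) ->
  convex_filter_base Q (hulls F).
Proof.
move=> FF FB; split.
- by eexists; exists setT => //; split; [exact: openT|exact: filterT].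
- move=> _ [U [oU FU] <-].
  have [y [Uy By]] := filter_ex (filterI FU FB).
  have [_ [[x Xx <-] Ux]] := By U (open_nbhs_nbhs (conj oU Uy)).
  by exists [:: (1, x)]; apply: midpoint_hull_point.
- by move=> _ z1 z2 [U _ <-]; exact: midpoint_hull_mid.
- move=> _ z q [U _ <-] + Qq; elim=> [x [Xx _]|z1 z2 _ h1 _ h2].
    by rewrite ev_seq1 Q_ball.
  rewrite ev_mid rnorm_half; have := ler_rnormD (ev q z1) (ev q z2); lra.
- move=> _ _ [U1 [oU1 FU1] <-] [U2 [oU2 FU2] <-].
  exists (midpoint_hull (ball_preimage (U1 `&` U2))).
    by exists (U1 `&` U2) => //; split; [exact: openI|exact: filterI].
  by move=> z hz; split; apply: midpoint_hull_sub hz => x [Xx []].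
Qed.

(** If not, F contains the complementary closed half-space, hence the open one
    bounded halfway; the images of the hull of the latter stay in it, so that y0
    is not adherent to them. *)
Lemma ultra_half_space (F : set_system (weak_topology Y)) (y0 : Y)
    (g : K -> R) (f : topological_dual Y) (e : R) :
  UltraFilter F ->
  (forall C (e : R), hulls F C -> 0 < e ->
    exists2 z, C z & rnorm (ev P z - y0) < e) ->
  real_coordinate g -> 0 < e ->
  F [set y | g (sval f y) < g (sval f y0) + e].
Proof.
move=> FU hy0 gc e0; have [gD gM gn] := gc.
have [//|FnA] :=
  in_ultra_setVsetC [set y | g (sval f y) < g (sval f y0) + e] FU.
pose c := g (sval f y0) + e / 2.
pose U : set Y := [set y | c < g (sval f y)].
have HU : hulls F (midpoint_hull (ball_preimage U)).
  exists U => //; split; first exact: open_half_space.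
  apply: filterS FnA => y /= /negP; rewrite -leNgt /U/= /c; lra.
have fc : {for y0, continuous (sval f : Y -> K^o)} := svalP f y0.
have e20 : 0 < e / 2 by rewrite divr_gt0.
have [r r0 fr] := nbhs_rnormP _ _ (fc _ (nbhs_rnorm (sval f y0 : K^o) _ e20)).
have [z hz zy0] := hy0 _ _ HU r0.
have : c < g (sval f (ev P z)).
  elim: hz {zy0} => [x [_]|z1 z2 _ h1 _ h2]; first by rewrite ev_seq1.
  rewrite ev_mid linearZ linearD /= gM gD; lra.
have := fr _ zy0; rewrite /= => h.
have := gn (sval f (ev P z) - sval f y0).
rewrite real_coordinateB// ler_norml => /andP[].
rewrite /c; lra.
Qed.

Lemma hulls_cvg (F : set_system (weak_topology Y)) (y0 : Y) :
  UltraFilter F ->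
  (forall C (e : R), hulls F C -> 0 < e ->
    exists2 z, C z & rnorm (ev P z - y0) < e) ->
  F --> (y0 : weak_topology Y).
Proof.
move=> FU hy0.
have FF : Filter F by exact: _.
apply/(@cvg_sup _ _ _ F y0 FF) => f A [_ [[V oV <-] Vy0] VA].
have [r r0 rV] := nbhs_rnormP _ _ (open_nbhs_nbhs (conj oV Vy0)).
have [g1 [g2 [g1c g2c gn]]] := @real_coordinates R k.
have r20 : 0 < r / 2 by rewrite divr_gt0.
have H g (gc : real_coordinate g) :=
  ultra_half_space F y0 g f (r / 2) FU hy0 gc r20.
have FA := @filterI _ F FF.
suff : F A by [].
have FA1 := FA _ _ (H _ g1c) (H _ (real_coordinateN _ g1c)).
have FA2 := FA _ _ (H _ g2c) (H _ (real_coordinateN _ g2c)).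
apply: (@filterS _ F FF) (FA _ _ FA1 FA2).
move=> y /= [[a1 a2] [b1 b2]].
apply: VA; apply: rV => /=.
have := gn (sval f y - sval f y0).
rewrite (real_coordinateB _ g1c) (real_coordinateB _ g2c).
have : `|g1 (sval f y) - g1 (sval f y0)| < r / 2.
  by rewrite ltr_norml; apply/andP; split; lra.
have : `|g2 (sval f y) - g2 (sval f y0)| < r / 2.
  by rewrite ltr_norml; apply/andP; split; lra.
lra.
Qed.

End WeakLimit.

Lemma rnorm_le_polynomial_norm (R : realType) (k : scalar_kind)
    (X Y : normedModType (scalar_field R k)) (q : X -> Y) (x : X) :
  (polynomial_norm q <= 1)%E -> unit_ball X x -> rnorm (q x) <= 1.
Proof.
move=> q1 Xx; rewrite -lee_fin; apply: le_trans q1.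
by apply: ereal_sup_ubound; exists x.
Qed.

Theorem theorem5p4 (R : realType) (k : scalar_kind) (p : R) (m : nat)
    (X Y : completeNormedModType (scalar_field R k)) (P : X -> Y)
    (hp : 1 <= p) (hm : (0 < m)%N)
    (hP : continuous_polynomials m X Y P)
    (hsum : factorable_strongly_summing p m P) :
  weakly_compact P.
Proof.
have p0 : 0 < p by exact: lt_le_trans hp.
have [C C0 {}hsum] := hsum.
have S := summing_seq p C _ Y P p0 C0 hsum.
have Qb q x : (continuous_polynomials m X (scalar_field R k)^o
    `&` [set q | (polynomial_norm q <= 1)%E]) q ->
    unit_ball X x -> rnorm (q x) <= 1.
  by move=> [_ q1]; exact: rnorm_le_polynomial_norm.
have approx CC delta :=
  approximate_limit _ P p (C `^ p) p0 (powR_ge0 _ _) S CC delta.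
rewrite /weakly_compact /relatively_weakly_compact precompactE compact_ultra.
move=> F FU FB.
have [y hy] := limit_point _ P approx _ (hulls_base _ P Qb F _ FB).
have Fy := hulls_cvg P F y FU hy.
exists y; split => //.
apply: (@closed_closure (weak_topology Y)) => A /Fy FA.
exact: filter_ex (filterI FB FA).
Qed.
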